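(* Let $f\colon\mathbb{R}^n\to\mathbb{R}$ be continuously differentiable, let $M\subset\mathbb{R}^n$ be closed, and let $K\colon\mathbb{R}^n\rightrightarrows\mathbb{R}^m$ be a set-valued mapping with closed graph. Consider the problems $$(\mathrm P)\quad \min_z\{f(z)\mid z\in M\cap\operatorname{dom}K\},\qquad (\mathrm Q)\quad \min_{z,\lambda}\{f(z)\mid z\in M,\ (z,\lambda)\in\operatorname{gph}K\}.$$ (a) If $\bar z\in\mathbb{R}^n$ is a local minimizer of $(\mathrm P)$, then $(\bar z,\bar\lambda)$ is a local minimizer of $(\mathrm Q)$ for each $\bar\lambda\in K(\bar z)$. (b) Let $\bar z\in\operatorname{dom}K$. If $(\bar z,\bar\lambda)$ is a local minimizer of $(\mathrm Q)$ for each $\bar\lambda\in K(\bar z)$, and if $K$ is inner semicompact at $\bar z$ w.r.t. $\operatorname{dom}K$, then $\bar z$ is a local minimizer of $(\mathrm P)$.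
   Context: For a set-valued mapping $K\colon\mathbb{R}^n\rightrightarrows\mathbb{R}^m$, $\operatorname{gph}K:=\{(z,\lambda)\mid\lambda\in K(z)\}$ and $\operatorname{dom}K:=\{z\mid K(z)\neq\emptyset\}$. $K$ is inner semicompact w.r.t. $\operatorname{dom}K$ at $\bar z\in\operatorname{dom}K$ if for each sequence $\{z_k\}\subset\operatorname{dom}K$ with $z_k\to\bar z$ there is a sequence $\{\lambda_k\}\subset\mathbb{R}^m$ possessing a bounded subsequence such that $\lambda_k\in K(z_k)$ for all $k\in\mathbb{N}$. Local minimizers are, as usual, feasible points which are minimal among all feasible points in some neighborhood. *)

(* Defs.v *)
From HB Require Import structures.
From mathcomp Require Import all_boot all_order all_algebra.
From mathcomp Require Import all_classical all_reals all_analysis.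

Set Implicit Arguments.
Unset Strict Implicit.
Unset Printing Implicit Defensive.

Import Order.TTheory GRing.Theory Num.Theory.
Import numFieldNormedType.Exports.
Local Open Scope classical_set_scope.
Local Open Scope ring_scope.

(* R^n is 'rV[R]_n, which carries the max norm; only its topology and its
   bounded sets, which are those of the Euclidean norm, matter below. *)

Definition gradient (R : realType) (n : nat) (f : 'rV[R]_n -> R)
  (z : 'rV[R]_n) : 'rV[R]_n := \row_i 'D_(delta_mx 0 i) f z.

Definition continuously_differentiable (R : realType) (n : nat)
  (f : 'rV[R]_n -> R) : Prop :=
  (forall z, differentiable f z) /\ continuous (gradient f).

(* A set-valued map from T to U is a function T -> set U. *)

Definition gph (T U : Type) (K : T -> set U) : set (T * U) :=
  [set p | K p.1 p.2].

Definition dom (T U : Type) (K : T -> set U) : set T := [set z | K z !=set0].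

Definition inner_semicompact_dom (R : realType) (n m : nat)
  (K : 'rV[R]_n -> set 'rV[R]_m) (zbar : 'rV[R]_n) : Prop :=
  forall z_ : nat -> 'rV[R]_n,
    (forall k, dom K (z_ k)) -> z_ @ \oo --> zbar ->
    exists lam : nat -> 'rV[R]_m,
      (exists phi : nat -> nat,
         increasing_seq phi /\ bounded_fun (lam \o phi)) /\
      (forall k, K (z_ k) (lam k)).

Definition local_minimizer (R : realType) (T : topologicalType)
  (f : T -> R) (F : set T) (x : T) : Prop :=
  F x /\ \forall y \near x, F y -> f x <= f y.

Definition localmin_P (R : realType) (n m : nat) (f : 'rV[R]_n -> R)
  (M : set 'rV[R]_n) (K : 'rV[R]_n -> set 'rV[R]_m) (z : 'rV[R]_n) : Prop :=
  local_minimizer f (M `&` dom K) z.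

Definition localmin_Q (R : realType) (n m : nat) (f : 'rV[R]_n -> R)
  (M : set 'rV[R]_n) (K : 'rV[R]_n -> set 'rV[R]_m)
  (z : 'rV[R]_n) (lam : 'rV[R]_m) : Prop :=
  local_minimizer (fun p : 'rV[R]_n * 'rV[R]_m => f p.1)
    [set p | M p.1 /\ gph K p] (z, lam).

(* Main.v *)
Require Import Defs.
From HB Require Import structures.
From mathcomp Require Import all_boot all_order all_algebra.
From mathcomp Require Import all_classical all_reals all_analysis.
Import Order.TTheory GRing.Theory Num.Theory.
Import numFieldNormedType.Exports.
Local Open Scope classical_set_scope.
Local Open Scope ring_scope.

(** The objective of (Q) depends on z alone, and (Q) is (P) with a multiplier
    attached to each feasible point.

    For (a), a neighborhood on which z is optimal in (P) pulls back along the
    first projection to one on which (z, lambda) is optimal in (Q): a point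
    feasible for (Q) projects to a point feasible for (P).

    For (b), if z were not locally optimal in (P), there would be points z_k of
    M and dom K tending to z with f (z_k) < f z.  Inner semicompactness gives
    multipliers lambda_k in K (z_k), bounded along a subsequence, which
    therefore have a cluster point lambda ([bounded_seq_cluster]).  As the z_k
    converge, (z, lambda) is a cluster point of the pairs (z_k, lambda_k)
    ([cluster_pair_cvg]), so it lies in the closed set gph K and, by hypothesis,
    is a local minimizer of (Q).  But every neighborhood of a cluster point
    meets the sequence, so some (z_k, lambda_k) satisfies f z <= f (z_k), a
    contradiction.  Cluster points suffice throughout: no convergent subsequence
    of multipliers has to be extracted. *)

Lemma increasing_seq_cvg_infty (phi : nat -> nat) :
  increasing_seq phi -> phi @ \oo --> \oo.
Proof.
move=> phi_incr.
have phi_ge k : (k <= phi k)%N.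
  elim: k => // k IHk; apply: (leq_ltn_trans IHk).
  by rewrite ltnNge -leEnat phi_incr ltnn.
move=> A [N _ NA]; exists N => // k /= Nk.
by apply: NA => /=; exact: leq_trans Nk (phi_ge k).
Qed.

(** The k-th point is chosen in the ball of radius 1 / (k + 1) around x. *)
Lemma not_near_seq (R : realType) (T : pseudoMetricType R) (x : T)
    (P : T -> Prop) :
  ~ (\forall y \near x, P y) ->
  exists2 u : nat -> T, u @ \oo --> x & forall k, ~ P (u k).
Proof.
move=> notP.
have ex k : {y | ball x (harmonic k : R) y /\ ~ P y}.
  apply: cid; apply: contrapT => noy; apply: notP.
  apply/nbhs_ballP; exists (harmonic k : R); first exact: harmonic_gt0.
  by move=> y xy; apply: contrapT => nPy; apply: noy; exists y.
exists (fun k => sval (ex k)) => [|k]; last by case: (svalP (ex k)).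
apply/cvg_ballP => e e0.
have /cvgr0_norm_lt/(_ e e0) := @cvg_harmonic R.
apply: filterS => k /=; rewrite ger0_norm ?harmonic_ge0 // => ke.
by apply: (le_ball (ltW ke)); case: (svalP (ex k)).
Qed.

(** Bolzano-Weierstrass: the closed ball containing the values is compact. *)
Lemma bounded_seq_cluster (R : realType) (m : nat) (u : nat -> 'rV[R]_m) :
  bounded_fun u -> exists l, cluster (u @ \oo) l.
Proof.
case=> B0 [_ uB0]; set B := B0 + 1.
have uB k : `|u k| <= B by apply: (uB0 B _ k I); rewrite ltrDl.
have cB : compact [set v : 'rV[R]_m | `|v| <= B].
  apply: bounded_closed_compact.
    exists B; split => [|b Bb v /= vB]; first exact: num_real.
    exact: le_trans vB (ltW Bb).
  have /continuous_closedP normC := @norm_continuous R 'rV[R]_m.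
  exact: normC (@closed_le R B).
have [|l [_ ul]] := cB (u @ \oo) _; last by exists l.
by exists 0%N => // k _; exact: uB.
Qed.

(** Consider a basic neighborhood A x B of (x, y).  Convergence gives a set of F
    on which u lies in A, clustering makes v take values in B somewhere on each
    set of F, and so some pair lies in A x B.  With u merely clustering at x, the
    two coordinates could be close to x and y for different indices only. *)
Lemma cluster_pair_cvg (I : Type) (T U : topologicalType) (F : set_system I)
    (FF : Filter F) (u : I -> T) (v : I -> U) (x : T) (y : U) :
  u @ F --> x -> cluster (v @ F) y ->
  cluster ((fun i => (u i, v i)) @ F) (x, y).
Proof.
move=> ux vy C D FC [[A B] [/= xA yB] ABD].
have FE : F (u @^-1` A `&` [set i | C (u i, v i)]).
  by apply: filterI => //; exact: ux.
have vE : (v @ F) (v @` (u @^-1` A `&` [set i | C (u i, v i)])).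
  by apply: (@filterS _ F _ _ _ _ FE) => i Ei; exists i.
have [_ [[i [Ai Ci] <-] Bi]] := vy _ _ vE yB.
by exists (u i, v i); split => //; exact: ABD.
Qed.

Lemma localmin_P_Q (R : realType) (n m : nat) (f : 'rV[R]_n -> R)
    (M : set 'rV[R]_n) (K : 'rV[R]_n -> set 'rV[R]_m) (z : 'rV[R]_n)
    (lam : 'rV[R]_m) :
  localmin_P f M K z -> K z lam -> localmin_Q f M K z lam.
Proof.
move=> [[Mz _] zmin] Kzl; split => //.
have : \forall p \near (z, lam), M p.1 /\ dom K p.1 -> f z <= f p.1.
  exact: (@cvg_fst _ _ (nbhs z) (nbhs lam) _ _ zmin).
apply: filterS => p pmin [Mp Kp].
by apply: pmin; split => //; exists p.2.
Qed.

Lemma localmin_Q_P (R : realType) (n m : nat) (f : 'rV[R]_n -> R)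
    (M : set 'rV[R]_n) (K : 'rV[R]_n -> set 'rV[R]_m) (z : 'rV[R]_n) :
  closed (gph K) -> dom K z -> (forall lam, K z lam -> localmin_Q f M K z lam) ->
  inner_semicompact_dom K z -> localmin_P f M K z.
Proof.
move=> clK domz Qmin semiK.
have Mz : M z by case: domz => lam /Qmin [[]].
split => //; apply: contrapT => /not_near_seq [u uz u_bad].
have u_feas k : (M `&` dom K) (u k).
  by apply: contrapT => nF; apply: (u_bad k) => /nF.
have u_lt k : f (u k) < f z.
  by rewrite ltNge; apply/negP => fz; exact: (u_bad k).
have [l [[phi [/increasing_seq_cvg_infty phioo bl]] Kul]] :=
  semiK u (fun k => (u_feas k).2) uz.
have [lbar lcl] := bounded_seq_cluster _ _ _ bl.
have uphi : (u \o phi) @ \oo --> z := cvg_comp _ _ phioo uz.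
have pcl : cluster ((fun k => (u (phi k), l (phi k))) @ \oo) (z, lbar).
  exact: (cluster_pair_cvg _ _ _ _ _ _ _ _ _ uphi lcl).
have Kzl : K z lbar.
  apply: (clK (z, lbar)) => B zB.
  by apply: (pcl (gph K) B _ zB); exists 0%N => // k _; exact: Kul.
have [_ near_min] := Qmin _ Kzl.
(* The values of the sequence of pairs form a set of its image filter, so the
   neighborhood of optimality contains one of these pairs. *)
have [|_ [[k _ <-] kmin]] :=
    pcl (range (fun k => (u (phi k), l (phi k)))) _ _ near_min.
  by exists 0%N => // k _; exists k.
have /= := kmin (conj (u_feas (phi k)).1 (Kul (phi k))).
by rewrite leNgt u_lt.
Qed.

Theorem theorem4p2 (R : realType) (n m : nat) (f : 'rV[R]_n -> R)
  (M : set 'rV[R]_n) (K : 'rV[R]_n -> set 'rV[R]_m)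
  (hf : continuously_differentiable f) (hM : closed M) (hK : closed (gph K)) :
  (forall zbar : 'rV[R]_n, localmin_P f M K zbar ->
     forall lambar : 'rV[R]_m, K zbar lambar -> localmin_Q f M K zbar lambar)
  /\
  (forall zbar : 'rV[R]_n, dom K zbar ->
     (forall lambar : 'rV[R]_m, K zbar lambar ->
        localmin_Q f M K zbar lambar) ->
     inner_semicompact_dom K zbar ->
     localmin_P f M K zbar).
Proof.
split=> [z zmin lam | z]; first exact: localmin_P_Q.
exact: localmin_Q_P.
Qed.
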